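(* Let $f:\mathbb{R}^n\to\mathbb{R}$ and let $\{\mathbf{x}_t\}_{t\in\mathbb{N}}$ be the sequence generated by the gradient descent algorithm $\mathbf{x}_{t+1}=\mathbf{x}_t-\eta_t\nabla f(\mathbf{x}_t)$, such that the standing assumptions (i)–(v) listed in the context hold; in particular $f$ is $L$-smooth and is a differentiable Łojasiewicz function with exponent $\theta\in(0,1)$. Let $\mathbf{x}_\infty$ be the limit of $\{\mathbf{x}_t\}_t$. Suppose there exist $\eta_-,\eta_+\in(0,\infty)$ such that $\eta_-\le\eta_t\le\eta_+$ for all $t$. If $\theta\in(0,\frac12]$, $-1\le\frac{L\eta_-^2}{2}-\eta_-<0$ and $-1\le\frac{L\eta_+^2}{2}-\eta_+<0$, then there exists a constant $Q>1$ such that $\{Q^t\|\mathbf{x}_t-\mathbf{x}_\infty\|\}_t$ converges to $0$ and $\{Q^t(f(\mathbf{x}_t)-f(\mathbf{x}_\infty))\}_t$ converges to $0$.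
   Context: $\|\cdot\|$ is the Euclidean norm. A critical point of a differentiable $f$ is a point where $\nabla f$ vanishes. $L$-smooth: $f:\mathbb{R}^n\to\mathbb{R}$ is $L$-smooth if it is continuously differentiable and $\|\nabla f(\mathbf{x})-\nabla f(\mathbf{x}')\|\le L\|\mathbf{x}-\mathbf{x}'\|$ for all $\mathbf{x},\mathbf{x}'\in\mathbb{R}^n$. Łojasiewicz function: a differentiable $f$ is a (differentiable) Łojasiewicz function with Łojasiewicz exponent $\theta\in(0,1)$ if for any $\mathbf{x}^*$ with $\nabla f(\mathbf{x}^* )=0$ there exist constants $\kappa,\mu>0$ such that $|f(\mathbf{x})-f(\mathbf{x}^* )|^\theta\le\kappa\|\nabla f(\mathbf{x})\|$ for all $\mathbf{x}$ with $\|\mathbf{x}-\mathbf{x}^*\|\le\mu$. Standing assumptions: (i) $f$ is $L$-smooth for some constant $L>0$; (ii) $f$ is a differentiable Łojasiewicz function with exponent $\theta$; (iii) $\inf_{\mathbf{x}\in\mathbb{R}^n}f(\mathbf{x})>-\infty$; (iv) all critical points of $f$ are isolated; (v) there exists a critical point $\mathbf{x}^*$ of $f$ such that the gradient descent sequence satisfies $\|\mathbf{x}_t-\mathbf{x}^*\|\le\mu$ for all $t$, where $\mu$ is the radius in the Łojasiewicz inequality at $\mathbf{x}^*$. *)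

(* Defs.v *)
From HB Require Import structures.
From mathcomp Require Import all_boot all_order all_algebra.
From mathcomp Require Import all_classical all_reals all_analysis.

Set Implicit Arguments.
Unset Strict Implicit.
Unset Printing Implicit Defensive.

Import Order.TTheory GRing.Theory Num.Theory.
Import numFieldNormedType.Exports.

Local Open Scope classical_set_scope.
Local Open Scope ring_scope.

(* R^n is 'rV[R]_n. The norm `|x| that the library puts on it is the sup norm,
   so the Euclidean norm is defined separately; the two norms are equivalent,
   so differentiability, continuity and limits may be taken from the library. *)
Definition enorm (R : realType) (n : nat) (x : 'rV[R]_n) : R :=
  Num.sqrt (\sum_(i < n) x ord0 i ^+ 2).

(* The vector of partial derivatives; it represents the differential only where
   f is differentiable, which the predicates below require. *)
Definition gradient (R : realType) (n : nat) (f : 'rV[R]_n -> R)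
    (p : 'rV[R]_n) : 'rV[R]_n :=
  \row_(i < n) 'D_(delta_mx ord0 i) f p.

Definition critical (R : realType) (n : nat) (f : 'rV[R]_n -> R) :
    set 'rV[R]_n :=
  [set p | gradient f p = 0].

Definition L_smooth (R : realType) (n : nat) (L : R) (f : 'rV[R]_n -> R) :
    Prop :=
  [/\ forall p, differentiable f p,
      continuous (gradient f) &
      forall p q, enorm (gradient f p - gradient f q) <= L * enorm (p - q)].

Definition lojasiewicz_at (R : realType) (n : nat) (theta : R)
    (f : 'rV[R]_n -> R) (xstar : 'rV[R]_n) (kappa mu : R) : Prop :=
  forall p, enorm (p - xstar) <= mu ->
    `|f p - f xstar| `^ theta <= kappa * enorm (gradient f p).

Definition lojasiewicz_function (R : realType) (n : nat) (theta : R)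
    (f : 'rV[R]_n -> R) : Prop :=
  [/\ 0 < theta < 1,
      forall p, differentiable f p &
      forall xstar, critical f xstar ->
        exists kappa mu : R,
          [/\ 0 < kappa, 0 < mu & lojasiewicz_at theta f xstar kappa mu]].

Definition gradient_descent (R : realType) (n : nat) (f : 'rV[R]_n -> R)
    (eta : nat -> R) (x : nat -> 'rV[R]_n) : Prop :=
  forall t, x t.+1 = x t - eta t *: gradient f (x t).

(* Main.v *)
Require Import Defs.
From HB Require Import structures.
From mathcomp Require Import all_boot all_order all_algebra.
From mathcomp Require Import all_classical all_reals all_analysis.
From mathcomp Require Import ring lra.

Set Implicit Arguments.
Unset Strict Implicit.
Unset Printing Implicit Defensive.

Import Order.TTheory GRing.Theory Num.Theory.
Import numFieldNormedType.Exports.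

Local Open Scope classical_set_scope.
Local Open Scope ring_scope.

(** Along a gradient step of size [e], an [L]-smooth function changes by at most
    [(L e^2 / 2 - e) |grad|^2]. This coefficient is convex in [e], so it is
    bounded by its larger value at the two ends of the range of the steps,
    which is [-c] for some [c > 0]: with [r t := f (x t) - f xstar] and
    [g t := |grad f (x t)|],

      r (t+1) <= r t - c (g t)^2.

    Since the whole orbit stays in the ball where the Lojasiewicz inequality at
    [xstar] holds, [|r t|^theta <= kappa g t]. If some [r T] were negative, [g]
    would stay bounded away from 0 after [T] and [f] would decrease without
    bound; hence [r >= 0] ([nonneg_gap]). As [theta <= 1/2] and [r] is bounded,
    the inequality gives [r t <= K (g t)^2] with a constant [K]
    ([le_sqr_of_powR_le]), and inserting this in the decrease yields
    [r (t+1) <= K / (K + c) r t] ([linear_decay]). The decrease also bounds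
    [(g t)^2] by [r t / c], so the steps [x (t+1) - x t] decay geometrically
    with ratio [s := sqrt (K / (K + c))]. Their sum converges, and the distance
    to the limit decays at the same rate ([geometric_steps_cvg]). By continuity
    [f xinf = f xstar], so both error sequences are [O(s^t)], and any
    [Q > 1] with [Q s < 1] works. *)

(** * Euclidean norm *)

Lemma enorm_ge0 (R : realType) n (u : 'rV[R]_n) : 0 <= enorm u.
Proof. exact: sqrtr_ge0. Qed.

Lemma enorm_sqr (R : realType) n (u : 'rV[R]_n) :
  enorm u ^+ 2 = \sum_(i < n) u ord0 i ^+ 2.
Proof. by rewrite sqr_sqrtr// sumr_ge0// => i _; exact: sqr_ge0. Qed.

Lemma enormZ (R : realType) n (a : R) (u : 'rV[R]_n) :
  enorm (a *: u) = `|a| * enorm u.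
Proof.
rewrite /enorm -sqrtr_sqr -sqrtrM ?sqr_ge0// mulr_sumr.
by congr Num.sqrt; apply: eq_bigr => i _; rewrite mxE exprMn.
Qed.

Lemma coord_le_enorm (R : realType) n (u : 'rV[R]_n) i :
  `|u ord0 i| <= enorm u.
Proof.
rewrite -sqrtr_sqr ler_wsqrtr// (bigD1 i)//= lerDl.
by rewrite sumr_ge0// => j _; exact: sqr_ge0.
Qed.

(** Together with [coord_le_enorm], this reduces limits in Euclidean norm to
    limits of coordinates. *)
Lemma enorm_le_coord (R : realType) n (u : 'rV[R]_n) (e : R) : 0 <= e ->
  (forall i, `|u ord0 i| <= e) -> enorm u <= Num.sqrt n%:R * e.
Proof.
move=> e0 ue; rewrite -[X in _ * X]ger0_norm// -sqrtr_sqr -sqrtrM//.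
rewrite ler_wsqrtr// mulr_natl -[X in _ *+ X]card_ord -sumr_const ler_sum// => i _.
by rewrite -ler_sqrt ?sqr_ge0// !sqrtr_sqr (ger0_norm e0).
Qed.

(** Weighted Young inequality [u v <= u^2 / (2 a) + a v^2 / 2] in each coordinate;
    the weight [a] bounds the ratio of the norms, so each of the two sums is at
    most [a |v|^2 / 2] and nothing is lost against Cauchy-Schwarz. *)
Lemma dot_le_young (R : realType) n (u v : 'rV[R]_n) (a : R) : 0 < a ->
  enorm u <= a * enorm v ->
  \sum_(i < n) u ord0 i * v ord0 i <= a * enorm v ^+ 2.
Proof.
move=> a0 uav.
have u2 : enorm u ^+ 2 <= a ^+ 2 * enorm v ^+ 2.
  by rewrite -exprMn ler_sqr// nnegrE ?enorm_ge0// mulr_ge0 ?enorm_ge0 ?ltW.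
apply: (@le_trans _ _ (enorm u ^+ 2 / (2 * a) + a / 2 * enorm v ^+ 2)).
  rewrite !enorm_sqr mulr_suml mulr_sumr -big_split ler_sum//= => i _.
  have : 0 <= (u ord0 i - a * v ord0 i) ^+ 2 / (2 * a).
    by rewrite divr_ge0 ?sqr_ge0// mulr_ge0 ?ltW.
  suff -> : (u ord0 i - a * v ord0 i) ^+ 2 / (2 * a) =
    u ord0 i ^+ 2 / (2 * a) + a / 2 * v ord0 i ^+ 2 - u ord0 i * v ord0 i
    by rewrite subr_ge0.
  by field; rewrite gt_eqF.
have : enorm u ^+ 2 / (2 * a) <= a / 2 * enorm v ^+ 2.
  rewrite ler_pdivrMr ?mulr_gt0//.
  by have -> : a / 2 * enorm v ^+ 2 * (2 * a) = a ^+ 2 * enorm v ^+ 2 by field.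
by move=> h; lra.
Qed.

Lemma enorm_cvg (R : realType) n (x : nat -> 'rV[R]_n) l :
  (fun t => enorm (x t - l)) @ \oo --> (0 : R) -> x @ \oo --> l.
Proof.
move=> /cvgrPdist_lt h; apply/cvgrPdist_lt => e e0.
apply: filterS (h e e0) => t; rewrite sub0r normrN ger0_norm ?enorm_ge0// => te.
rewrite -normrN opprB [ltLHS]mx_normrE; apply/bigmax_ltP; split => // -[i j] _ /=.
by rewrite ord1 (le_lt_trans (coord_le_enorm _ _)).
Qed.

(** * Decrease of a smooth function along a gradient step *)

Lemma derive_gradient (R : realType) n (f : 'rV[R]_n -> R) p v :
  differentiable f p ->
  'D_v f p = \sum_(i < n) gradient f p ord0 i * v ord0 i.
Proof.
move=> df; rewrite deriveE// [v in LHS]row_sum_delta linear_sum/=.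
by apply: eq_bigr => i _; rewrite linearZ/= mxE deriveE// mulrC.
Qed.

(** The difference quotient of [f] on the line through [p] at parameter [s] is,
    up to reassociation, the one that defines ['D_v f (p + s *: v)]. *)
Lemma is_derive_line (R : realType) n (f : 'rV[R]_n -> R) (p v : 'rV[R]_n)
    (s : R) : differentiable f (p + s *: v) ->
  is_derive s 1 (fun h => f (p + h *: v)) ('D_v f (p + s *: v)).
Proof.
move=> df; have dv : derivable f (p + s *: v) v by exact: diff_derivable.
have E : (fun h : R => h^-1 *: (((fun h => f (p + h *: v)) \o shift s) (h *: 1)
      - f (p + s *: v))) =
    (fun h => h^-1 *: ((f \o shift (p + s *: v)) (h *: v) - f (p + s *: v))).
  apply/funext => h /=; congr (_ *: (f _ - _)).
  by rewrite [h *: 1]mulr1 scalerDl addrCA.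
by split; rewrite /derivable /derive E.
Qed.

(** The quadratic upper bound for smooth functions. On the segment from [p] to
    [p + v], subtract from [f] the linear part [s d] and the quadratic part
    [s^2 w]: the Lipschitz bound on the gradient makes the derivative of the
    difference nonpositive, and the mean value theorem concludes without
    integrating. *)
Lemma descent (R : realType) n (L : R) (f : 'rV[R]_n -> R) (p v : 'rV[R]_n) :
  0 < L -> L_smooth L f ->
  f (p + v) <= f p + \sum_(i < n) gradient f p ord0 i * v ord0 i
               + L / 2 * enorm v ^+ 2.
Proof.
move=> L0 [df _ Lf].
set d := \sum_(i < n) _; set w := L / 2 * _.
pose phi := fun s : R => f (p + s *: v).
pose psi := phi - (d *: (id : R -> R) + w *: (id : R -> R) ^+ 2).
pose dpsi := fun s : R => 'D_v f (p + s *: v) - (d + 2 * s * w).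
have dP (s : R) : is_derive s (1 : R) psi (dpsi s).
  have l : is_derive s (1 : R) phi ('D_v f (p + s *: v)) by exact: is_derive_line.
  have q : is_derive s (1 : R)
      (d *: (id : R -> R) + w *: (id : R -> R) ^+ 2) (d + 2 * s * w).
    have i := @is_derive_id R R s 1.
    have h := is_deriveD (is_deriveZ d i) (is_deriveZ w (is_deriveX 2 i)).
    by apply: is_derive_eq h _; rewrite /GRing.scale/= expr1; ring.
  exact: is_deriveB.
have [|s] := @MVT R psi dpsi 0 1 ltr01 (fun s _ => dP s).
  by apply: derivable_within_continuous => s _; exact: @ex_derive.
rewrite in_itv/= => /andP[s0 s1].
have psiE a : psi a = f (p + a *: v) - (d * a + w * a ^+ 2) by [].
rewrite subr0 mulr1 !psiE scale1r scale0r addr0 => E.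
suff : dpsi s <= 0 by lra.
rewrite /dpsi derive_gradient//.
have : \sum_(i < n) (gradient f (p + s *: v) - gradient f p) ord0 i * v ord0 i
    <= L * s * enorm v ^+ 2.
  apply: dot_le_young; first exact: mulr_gt0.
  apply: le_trans (Lf _ _) _.
  by rewrite addrAC subrr add0r enormZ gtr0_norm// mulrA.
have -> : \sum_(i < n) (gradient f (p + s *: v) - gradient f p) ord0 i * v ord0 i
    = \sum_(i < n) gradient f (p + s *: v) ord0 i * v ord0 i - d.
  by rewrite /d -sumrB; apply: eq_bigr => i _; rewrite !mxE mulrBl.
by rewrite /w => h; lra.
Qed.

Lemma gradient_step_decrease (R : realType) n (L : R) (f : 'rV[R]_n -> R)
    (e : R) (p : 'rV[R]_n) : 0 < L -> L_smooth L f ->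
  f (p - e *: gradient f p) <=
  f p + (L * e ^+ 2 / 2 - e) * enorm (gradient f p) ^+ 2.
Proof.
move=> L0 fL; apply: le_trans (descent _ _ L0 fL) _.
have -> : \sum_(i < n) gradient f p ord0 i * (- (e *: gradient f p)) ord0 i
    = - e * enorm (gradient f p) ^+ 2.
  by rewrite enorm_sqr mulr_sumr; apply: eq_bigr => i _; rewrite !mxE; ring.
rewrite -scaleNr enormZ exprMn normrN real_normK ?num_real//.
by lra.
Qed.

(** The left side is a convex function of [e]. The chord slopes from [e] to [a]
    and from [e] to [b] cannot both have the wrong sign; the case split is on
    the sign of the slope from [e] to [b]. *)
Lemma step_coef (R : realFieldType) (L a b e : R) : 0 <= L -> a <= e <= b ->
  L * e ^+ 2 / 2 - e <=
  Num.max (L * a ^+ 2 / 2 - a) (L * b ^+ 2 / 2 - b).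
Proof.
move=> L0 /andP[ae eb]; rewrite le_max.
have [h|h] := leP (L * (e + b) / 2) 1.
  apply/orP; left.
  have : 0 <= (e - a) * (1 - L * (e + a) / 2).
    apply: mulr_ge0; first by lra.
    have : L * (e + a) <= L * (e + b) by apply: ler_wpM2l => //; lra.
    by lra.
  by lra.
apply/orP; right.
have : 0 <= (b - e) * (L * (e + b) / 2 - 1) by apply: mulr_ge0; lra.
by lra.
Qed.

(** * Sequences with geometric bounds *)

(** With [K := C / (1 - s)], the tail of the geometric series from [t] on is
    [K s^t]. So [u t - K s^t] increases, [u t + K s^t] decreases, and they
    enclose the limit, which is the supremum of the former. *)
Lemma geometric_increments_cvg (R : realType) (u : nat -> R) (C s : R) :
  0 <= C -> 0 <= s < 1 -> (forall t, `|u t.+1 - u t| <= C * s ^+ t) ->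
  exists l, forall t, `|u t - l| <= C / (1 - s) * s ^+ t.
Proof.
move=> C0 /andP[s0 s1] us; set K := C / (1 - s).
have s1' : 1 - s != 0 by rewrite gt_eqF// subr_gt0.
have KC : K * (1 - s) = C by rewrite divfK.
pose a t := u t - K * s ^+ t; pose b t := u t + K * s ^+ t.
have Ks0 t : 0 <= K * s ^+ t.
  by rewrite !mulr_ge0 ?exprn_ge0// invr_ge0 subr_ge0 ltW.
have ab t : a t <= b t by rewrite /a /b; have := Ks0 t; lra.
have KE t : K * s ^+ t - K * s ^+ t.+1 = C * s ^+ t by rewrite exprS -KC; ring.
have a_nd : nondecreasing_seq a.
  apply/nondecreasing_seqP => t; have := us t; rewrite ler_norml => /andP[h _].
  by have := KE t; rewrite /a; lra.
have b_ni : nonincreasing_seq b.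
  apply/nonincreasing_seqP => t; have := us t; rewrite ler_norml => /andP[_ h].
  by have := KE t; rewrite /b; lra.
have a_le_b t t' : a t <= b t'.
  apply: (le_trans (a_nd _ _ (leq_maxl t t'))).
  exact: le_trans (ab _) (b_ni _ _ (leq_maxr t t')).
have a_ub t : ubound (range a) (b t) by move=> _ [t' _ <-].
have a_sup : has_sup (range a) by split; [exists (a 0), 0 | exists (b 0)].
exists (sup (range a)) => t; rewrite ler_norml.
have : a t <= sup (range a) by apply: ub_le_sup; [exact: a_sup.2 | exists t].
have : sup (range a) <= b t by apply: ge_sup => //; exact: a_sup.1.
by rewrite /a /b => *; apply/andP; split; lra.
Qed.

(** The factor [A] is the scalar constant [C / (1 - s)] times [sqrt n], the cost
    of passing to a limit coordinate by coordinate. *)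
Lemma geometric_steps_cvg (R : realType) n (x : nat -> 'rV[R]_n) (C s : R) :
  0 <= C -> 0 <= s < 1 ->
  (forall t, enorm (x t.+1 - x t) <= C * s ^+ t) ->
  exists l (A : R), forall t, enorm (x t - l) <= A * s ^+ t.
Proof.
move=> C0 s01 xs; have /andP[s0 s1] := s01.
have /choice[l lP] : forall i : 'I_n, exists l, forall t,
    `|x t ord0 i - l| <= C / (1 - s) * s ^+ t.
  move=> i; apply: geometric_increments_cvg => // t.
  by apply: le_trans (xs t); have := coord_le_enorm (x t.+1 - x t) i; rewrite !mxE.
exists (\row_i l i), (Num.sqrt n%:R * (C / (1 - s))) => t; rewrite -mulrA.
apply: enorm_le_coord => [|i]; last by rewrite !mxE.
by rewrite !mulr_ge0 ?exprn_ge0// invr_ge0 subr_ge0 ltW.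
Qed.

Lemma geometric_bound_cvg0 (R : realType) (u : nat -> R) (A s Q : R) :
  0 <= s -> 0 <= Q -> Q * s < 1 ->
  (forall t, 0 <= u t <= A * s ^+ t) -> (fun t => Q ^+ t * u t) @ \oo --> (0 : R).
Proof.
move=> s0 Q0 Qs ub.
have lim0 : geometric A (Q * s) @ \oo --> (0 : R).
  by apply: cvg_geometric; rewrite ger0_norm// mulr_ge0.
apply: squeeze_cvgr (cvg_cst 0) lim0; apply: nearW => t /=.
have /andP[u0 uA] := ub t.
rewrite mulr_ge0 ?exprn_ge0//= exprMn mulrCA.
by rewrite ler_wpM2l// exprn_ge0.
Qed.

(** * Decay of the values from the Lojasiewicz inequality *)

Lemma lower_bound_of_inf (R : realType) T (f : T -> R) :
  (-oo < ereal_inf (range (fun p => (f p)%:E)))%E ->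
  exists m, forall p, m <= f p.
Proof.
move=> finf; have inf_le p : (ereal_inf (range (fun p => (f p)%:E)) <= (f p)%:E)%E.
  by apply: ereal_inf_lbound; exists p.
case: (ereal_inf _) finf inf_le => // [m _ h|_ h].
  by exists m => p; rewrite -lee_fin.
by exists 0 => p; have := h p.
Qed.

(** [r] is nonincreasing, so once it is negative at [T], [|r|] stays at least
    [|r T|]. The Lojasiewicz inequality then keeps [g] above a positive [d], and
    [r] loses at least [c d^2] at each step, against the lower bound [m]. *)
Lemma nonneg_gap (R : realType) (r g : nat -> R) (th kappa c m : R) :
  0 < c -> 0 < kappa -> 0 < th -> (forall t, 0 <= g t) ->
  (forall t, m <= r t) ->
  (forall t, r t.+1 <= r t - c * g t ^+ 2) ->
  (forall t, `|r t| `^ th <= kappa * g t) ->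
  forall t, 0 <= r t.
Proof.
move=> c0 k0 th0 g0 rm dec loj T; rewrite leNgt; apply/negP => rT.
have r_ni : nonincreasing_seq r.
  apply/nonincreasing_seqP => t; apply: le_trans (dec t) _.
  by rewrite gerBl mulr_ge0 ?sqr_ge0// ltW.
set d := `|r T| `^ th / kappa.
have d0 : 0 < d by rewrite divr_gt0// powR_gt0// normr_gt0 lt_eqF.
have dg k : d <= g (T + k)%N.
  rewrite ler_pdivrMr// mulrC; apply: le_trans (loj _).
  have rTk : r (T + k)%N <= r T by apply: r_ni; exact: leq_addr.
  apply: ge0_ler_powR; rewrite ?nnegrE ?normr_ge0 ?(ltW th0)//.
  by rewrite !ltr0_norm ?lerN2// (le_lt_trans rTk).
have drop k : r (T + k)%N <= r T - k%:R * (c * d ^+ 2).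
  elim: k => [|k IH]; first by rewrite addn0 mul0r subr0.
  rewrite addnS; apply: le_trans (dec _) _.
  have : c * d ^+ 2 <= c * g (T + k)%N ^+ 2.
    by rewrite ler_wpM2l ?(ltW c0)// ler_sqr ?nnegrE// ltW.
  by rewrite -natr1 mulrDl mul1r; lra.
have e0 : 0 < c * d ^+ 2 by rewrite mulr_gt0// exprn_gt0.
have := archi_boundP (_ : 0 <= (r T - m) / (c * d ^+ 2)).
rewrite divr_ge0 ?subr_ge0 ?(ltW e0)// => /(_ isT).
rewrite ltr_pdivrMr// => h.
have := drop (Num.bound ((r T - m) / (c * d ^+ 2))).
by have := rm (T + Num.bound ((r T - m) / (c * d ^+ 2)))%N; lra.
Qed.

(** [sqrt r = r^(1/2 - th) * r^th]; since [th <= 1/2], the exponent of the first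
    factor is nonnegative, so this factor is at most [M^(1/2 - th)]. *)
Lemma le_sqr_of_powR_le (R : realType) (r M th G : R) :
  0 <= r <= M -> 0 < th <= 1 / 2 -> r `^ th <= G ->
  r <= (M `^ (2^-1 - th) * G) ^+ 2.
Proof.
move=> /andP[r0 rM] /andP[th0 th2] rG.
rewrite -[leLHS]sqr_sqrtr// ler_sqr ?nnegrE ?sqrtr_ge0//; last first.
  by rewrite mulr_ge0 ?powR_ge0// (le_trans (powR_ge0 _ _) rG).
rewrite -powR12_sqrt// -[X in r `^ X](subrK th) powRD; last first.
  by rewrite subrK invr_eq0 pnatr_eq0.
apply: ler_pM; rewrite ?powR_ge0//.
apply: ge0_ler_powR; rewrite ?nnegrE// ?(le_trans r0 rM)//.
by rewrite subr_ge0; lra.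
Qed.

(** The ratio is presented as a square because gradient norms, hence the steps of
    the iteration, decay like the square root of [r]. *)
Lemma linear_decay (R : realType) (r g : nat -> R) (th kappa c : R) :
  0 < c -> 0 < kappa -> 0 < th <= 1 / 2 -> (forall t, 0 <= r t) ->
  (forall t, r t.+1 <= r t - c * g t ^+ 2) ->
  (forall t, r t `^ th <= kappa * g t) ->
  exists s, 0 <= s < 1 /\ forall t, r t <= r 0%N * (s ^+ t) ^+ 2.
Proof.
move=> c0 k0 th0 r0 dec loj.
have r_ni : nonincreasing_seq r.
  apply/nonincreasing_seqP => t; apply: le_trans (dec t) _.
  by rewrite gerBl mulr_ge0 ?sqr_ge0// ltW.
set K := (r 0%N `^ (2^-1 - th) * kappa) ^+ 2.
have K0 : 0 <= K by exact: sqr_ge0.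
have Kc0 : 0 < K + c by rewrite ltr_wpDl.
have rK t : r t <= K * g t ^+ 2.
  rewrite -exprMn -mulrA; apply: le_sqr_of_powR_le th0 (loj t).
  by rewrite r0 r_ni.
(* Inserting rK in the decrease directly would give the ratio 1 - c / K, which
   is negative when K < c and meaningless when K = 0, whereas K / (K + c)
   always lies in [0, 1). *)
set q := K / (K + c).
have q0 : 0 <= q by rewrite divr_ge0// ltW.
exists (Num.sqrt q); split.
  rewrite sqrtr_ge0 -[ltRHS]sqrtr1 ltr_sqrt//= ltr_pdivrMr// mul1r.
  by rewrite ltrDl.
elim=> [|t IH]; first by rewrite expr0 expr1n mulr1.
have step : r t.+1 <= q * r t.
  rewrite mulrAC ler_pdivlMr//.
  have h1 : K * r t.+1 <= K * (r t - c * g t ^+ 2) by rewrite ler_wpM2l.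
  have h2 : c * r t <= c * (K * g t ^+ 2) by rewrite ler_wpM2l// ltW.
  have h3 : c * r t.+1 <= c * r t by rewrite ler_wpM2l ?(ltW c0)// r_ni.
  by lra.
apply: le_trans step _; rewrite (exprS (Num.sqrt q)) exprMn sqr_sqrtr// mulrCA.
by rewrite ler_wpM2l.
Qed.

(** * Linear convergence of gradient descent *)

Theorem corollary1 (R : realType) (n : nat) (f : 'rV[R]_n -> R)
  (eta : nat -> R) (x : nat -> 'rV[R]_n) (L theta eta_m eta_p : R)
  (x_gd : gradient_descent f eta x)
  (L_gt0 : 0 < L)
  (f_smooth : L_smooth L f)
  (f_loja : lojasiewicz_function theta f)
  (f_inf : (-oo < ereal_inf (range (fun p => (f p)%:E)))%E)
  (f_isolated : forall p, critical f p -> isolated (critical f) p)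
  (x_local : exists (xstar : 'rV[R]_n) (kappa mu : R),
     [/\ critical f xstar, 0 < kappa, 0 < mu,
         lojasiewicz_at theta f xstar kappa mu &
         forall t, enorm (x t - xstar) <= mu])
  (eta_m_gt0 : 0 < eta_m)
  (eta_p_gt0 : 0 < eta_p)
  (eta_bounds : forall t, eta_m <= eta t <= eta_p)
  (theta_range : 0 < theta <= 1 / 2)
  (eta_m_range : -1 <= L * eta_m ^+ 2 / 2 - eta_m < 0)
  (eta_p_range : -1 <= L * eta_p ^+ 2 / 2 - eta_p < 0) :
  exists xinf : 'rV[R]_n, x @ \oo --> xinf /\
    exists Q : R, [/\ 1 < Q,
      (fun t => Q ^+ t * enorm (x t - xinf)) @ \oo --> (0 : R) &
      (fun t => Q ^+ t * (f (x t) - f xinf)) @ \oo --> (0 : R)].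
Proof.
have [xstar [kappa [mu [_ kappa0 _ loj xmu]]]] := x_local.
have /andP[_ hm] := eta_m_range; have /andP[_ hp] := eta_p_range.
have /andP[theta0 _] := theta_range.
set M := Num.max (L * eta_m ^+ 2 / 2 - eta_m) (L * eta_p ^+ 2 / 2 - eta_p).
have M0 : 0 < - M by rewrite oppr_gt0 gt_max hm hp.
pose g t := enorm (gradient f (x t)).
pose r t := f (x t) - f xstar.
have g0 t : 0 <= g t by exact: enorm_ge0.
have dec t : r t.+1 <= r t - - M * g t ^+ 2.
  have := gradient_step_decrease (eta t) (x t) L_gt0 f_smooth.
  rewrite -x_gd -/(g t) => h.
  have := ler_wpM2r (sqr_ge0 (g t)) (step_coef (ltW L_gt0) (eta_bounds t)).
  by rewrite -/M /r; lra.
have [m rm] : exists m, forall t, m <= r t.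
  have [m fm] := lower_bound_of_inf f_inf.
  by exists (m - f xstar) => t; rewrite lerD2r.
have rloj t : `|r t| `^ theta <= kappa * g t by exact: loj (xmu t).
have r0 := nonneg_gap M0 kappa0 theta0 g0 rm dec rloj.
have [t|s [s01 rs]] := linear_decay (g := g) M0 kappa0 theta_range r0 dec.
  by rewrite -{1}(ger0_norm (r0 t)).
have /andP[s0 s1] := s01.
have gs t : g t <= Num.sqrt (r 0%N / - M) * s ^+ t.
  rewrite -[s ^+ t]ger0_norm ?exprn_ge0// -sqrtr_sqr -sqrtrM; last first.
    by rewrite divr_ge0// ltW.
  rewrite -[leLHS]ger0_norm// -sqrtr_sqr ler_wsqrtr// mulrAC ler_pdivlMr//.
  by have := dec t; have := rs t; have := r0 t.+1; lra.
have xs t : enorm (x t.+1 - x t) <= eta_p * Num.sqrt (r 0%N / - M) * s ^+ t.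
  have /andP[em ep] := eta_bounds t.
  rewrite x_gd addrAC subrr add0r -scaleNr enormZ normrN -mulrA.
  rewrite ger0_norm ?(le_trans (ltW eta_m_gt0))//.
  exact: ler_pM (le_trans (ltW eta_m_gt0) em) (g0 t) ep (gs t).
have [|xinf [A xA]] := geometric_steps_cvg _ s01 xs.
  by rewrite mulr_ge0 ?sqrtr_ge0// ltW.
(* One factor s^t is discarded so that both errors have the same rate. *)
have rs' t : 0 <= r t <= r 0%N * s ^+ t.
  rewrite r0 (le_trans (rs t))// ler_wpM2l// expr2.
  by rewrite ler_piMl ?exprn_ge0// exprn_ile1// ltW.
have x0 t : 0 <= enorm (x t - xinf) <= A * s ^+ t by rewrite enorm_ge0 xA.
have cvg1 u B : (forall t, 0 <= u t <= B * s ^+ t) -> u @ \oo --> (0 : R).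
  move=> uB; have := geometric_bound_cvg0 s0 ler01 _ uB; rewrite mul1r.
  by under eq_fun do rewrite expr1n mul1r; exact.
have xcvg : x @ \oo --> xinf by apply: enorm_cvg; exact: cvg1 x0.
have finf : f xinf = f xstar.
  have [df _ _] := f_smooth.
  have fx1 : (f \o x) @ \oo --> f xinf.
    exact: continuous_cvg (differentiable_continuous (df xinf)) xcvg.
  have fx2 : (f \o x) @ \oo --> f xstar.
    by apply/subr_cvg0; exact: cvg1 rs'.
  exact: cvg_unique fx1 fx2.
(* For s > 0 this is the harmonic mean of 1 and 1 / s; it also covers s = 0. *)
exists xinf; split=> //; exists (2 / (1 + s)).
have s2 : 0 < 1 + s by rewrite ltr_pwDl.
have Q0 : 0 <= 2 / (1 + s) by rewrite divr_ge0// ltW.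
have Qs : 2 / (1 + s) * s < 1 by rewrite mulrAC ltr_pdivrMr//; lra.
split.
- by rewrite ltr_pdivlMr//; lra.
- exact: geometric_bound_cvg0 s0 Q0 Qs x0.
- by rewrite finf; exact: geometric_bound_cvg0 s0 Q0 Qs rs'.
Qed.
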